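(* Let $K$ be a field, let $G$ be a finite simple graph on the vertex set $[n]=\{1,\dots,n\}$, and let $J_G\subset S=K[x_1,\dots,x_n,y_1,\dots,y_n]$ be its binomial edge ideal. Then the following conditions are equivalent: (i) $G$ is complete around all vertices of $G$. (ii) All connected components of $G$ are complete graphs. (iii) $J_G$ is a prime ideal. (iv) $J_G$ is a lattice ideal. (v) $J_G$ is a toric ideal, and it is a sum of toric ideals associated to some complete bipartite graphs; that is, $J_G$ is toric and there are finitely many complete bipartite graphs $H_1,\dots,H_s$, together with injections of each edge set $E(H_j)$ into the set of variables of $S$, such that $J_G=\sum_{j=1}^s I_{H_j}S$, where $I_{H_j}S$ is the ideal of $S$ generated by the toric ideal $I_{H_j}$ of $H_j$ written in the corresponding variables of $S$.
   Context: Binomial edge ideal: $J_G$ is the ideal of $S$ generated by the binomials $x_iy_j-x_jy_i$ with $\{i,j\}\in E(G)$. Complete around all vertices: $G$ is complete around all vertices if for every vertex $k$ the neighbourhood $N(k)=\{i : \{i,k\}\in E(G)\}$ induces a complete subgraph, i.e. any two distinct $i,j\in N(k)$ satisfy $\{i,j\}\in E(G)$. Lattice ideal: a partial character on $\mathbb{Z}^N$ is a group homomorphism $\rho:L_\rho\to K^\ast=K\setminus\{0\}$ from a subgroup (lattice) $L_\rho\subseteq\mathbb{Z}^N$. For $m\in\mathbb{Z}^N$ let $m_+,m_-\in\mathbb{Z}_{\ge0}^N$ be its positive and negative parts, $m=m_+-m_-$. In a polynomial ring $K[z_1,\dots,z_N]$ put $I_+(\rho)=\langle z^{m_+}-\rho(m)z^{m_-}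 : m\in L_\rho\rangle$. An ideal $I$ of $K[z_1,\dots,z_N]$ is a lattice ideal if $I=I_+(\rho)$ for some partial character $\rho$ on $\mathbb{Z}^N$. Here this is applied to $S$, with $N=2n$. Toric ideal: an ideal of a polynomial ring $K[z_1,\dots,z_N]$ is toric if it is the kernel of a $K$-algebra homomorphism from $K[z_1,\dots,z_N]$ to a polynomial ring over $K$ in finitely many variables that sends each variable $z_k$ to a monomial (with coefficient $1$). Toric ideal associated to a graph: for a finite simple graph $H$ with edges $e_1,\dots,e_q$, $I_H$ is the kernel of the $K$-algebra homomorphism $K[t_1,\dots,t_q]\to K[w_v: v\in V(H)]$ sending $t_k$ to $w_uw_v$ where $e_k=\{u,v\}$. *)

(* Defs.v *)
From HB Require Import structures.
From mathcomp Require Import all_boot all_order all_algebra.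
From mathcomp Require Import boolp mpoly.

Set Implicit Arguments.
Unset Strict Implicit.
Unset Printing Implicit Defensive.

Import Order.TTheory GRing.Theory Num.Theory.
Local Open Scope ring_scope.

Record sgraph (V : finType) := SGraph {
  adj :> rel V;
  adj_sym : ssrbool.symmetric adj;
  adj_irrefl : irreflexive adj }.

Section Graphs.
Variables (V : finType) (G : sgraph V).

Definition nbhd (k : V) : {set V} := [set i | G i k].

Definition complete_on (A : {set V}) : Prop :=
  {in A &, forall i j, i != j -> G i j}.

Definition complete_around_all_vertices : Prop :=
  forall k : V, complete_on (nbhd k).

Definition components : {set {set V}} :=
  equivalence_partition (connect G) [set: V].

Definition edges : {set {set V}} :=
  [set e : {set V} | [exists u, exists v, G u v && (e == [set u; v])]].

Definition complete_bipartite : Prop :=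
  exists2 A : {set V}, A != set0 /\ ~: A != set0 &
    forall u v, G u v = ((u \in A) != (v \in A)).

End Graphs.

Section Ideals.
Variable R : comNzRingType.

Definition ideal_gen (A : R -> Prop) : {pred R} :=
  [pred f | `[< exists s : seq (R * R),
                  (forall p, p \in s -> A p.2) /\
                  f = \sum_(p <- s) p.1 * p.2 >]].

Definition ideal_sum (s : nat) (I : 'I_s -> {pred R}) : {pred R} :=
  [pred f | `[< exists g : 'I_s -> R,
                  (forall j, g j \in I j) /\ f = \sum_j g j >]].

(* [idealr_closed] includes properness: it asks for 1 \notin I. *)
Definition prime_ideal (I : {pred R}) : Prop :=
  idealr_closed I /\ prime_idealr_closed I.

End Ideals.

Section BinomialEdgeIdeal.
Variables (K : fieldType) (n : nat).

Definition varx (i : 'I_n) : {mpoly K[n + n]} := 'X_(lshift n i).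
Definition vary (i : 'I_n) : {mpoly K[n + n]} := 'X_(rshift n i).

Definition binomial_edge_ideal (G : sgraph 'I_n) : {pred {mpoly K[n + n]}} :=
  ideal_gen (fun f => exists i j : 'I_n,
    G i j /\ f = varx i * vary j - varx j * vary i).

End BinomialEdgeIdeal.

Arguments binomial_edge_ideal K [n] G _.

(* The values of [pc_fun] outside the lattice are irrelevant. *)
Record partial_character (K : fieldType) (N : nat) := PartialCharacter {
  pc_lattice : {pred 'rV[int]_N};
  pc_fun :> 'rV[int]_N -> K;
  pc_lattice_closed : zmod_closed pc_lattice;
  pc_neq0 : {in pc_lattice, forall m, pc_fun m != 0};
  pc_morph : {in pc_lattice &,
    {morph pc_fun : m1 m2 / m1 + m2 >-> m1 * m2}} }.

Definition pos_part (N : nat) (m : 'rV[int]_N) : 'X_{1..N} :=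
  [multinom `|Num.max (m 0%R i) 0%R|%N | i < N].
Definition neg_part (N : nat) (m : 'rV[int]_N) : 'X_{1..N} :=
  pos_part (- m).

Definition character_ideal (K : fieldType) (N : nat)
    (rho : partial_character K N) : {pred {mpoly K[N]}} :=
  ideal_gen (fun f => exists2 m : 'rV[int]_N, m \in pc_lattice rho &
    f = 'X_[pos_part m] - rho m *: 'X_[neg_part m]).

Definition is_lattice_ideal (K : fieldType) (N : nat)
    (I : {pred {mpoly K[N]}}) : Prop :=
  exists rho : partial_character K N, I =i character_ideal rho.

Definition is_toric_ideal (K : fieldType) (N : nat)
    (I : {pred {mpoly K[N]}}) : Prop :=
  exists (M : nat) (phi : {lrmorphism {mpoly K[N]} -> {mpoly K[M]}}),
    (forall k : 'I_N, exists m : 'X_{1..M}, phi 'X_k = 'X_[m]) /\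
    (forall f, (f \in I) = (phi f == 0)).

Section GraphToricIdeal.
Variables (K : fieldType) (V : finType) (H : sgraph V).

(* t_k |-> w_u w_v, where the k-th edge [enum_val k] is {u, v} *)
Definition edge_monomial (k : 'I_#|edges H|) : {mpoly K[#|V|]} :=
  \prod_(v in enum_val k) 'X_(enum_rank v).

Definition graph_toric_ideal : {pred {mpoly K[#|edges H|]}} :=
  [pred f | f \mPo [tuple edge_monomial k | k < #|edges H|] == 0].

Definition graph_toric_ideal_ext (N : nat) (iota : 'I_#|edges H| -> 'I_N) :
    {pred {mpoly K[N]}} :=
  ideal_gen (fun f => exists2 h : {mpoly K[#|edges H|]},
    h \in graph_toric_ideal & f = h \mPo [tuple 'X_(iota k) | k < #|edges H|]).

End GraphToricIdeal.

Definition is_sum_of_complete_bipartite_toric (K : fieldType) (N : nat)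
    (I : {pred {mpoly K[N]}}) : Prop :=
  exists (s : nat) (V : 'I_s -> finType) (H : forall j, sgraph (V j))
         (iota : forall j, 'I_#|edges (H j)| -> 'I_N),
    [/\ forall j, complete_bipartite (H j),
        forall j, injective (iota j) &
        I =i ideal_sum (fun j => graph_toric_ideal_ext (iota j))].

(* Main.v *)
(* When the components of G are complete, J_G is the kernel of the monomial map
   x_i |-> t_i u_c, y_i |-> t_i v_c, where c is the component of i: two monomials
   with the same image are connected by exchanges x_i y_j -> x_j y_i inside a
   component. Hence J_G is toric, prime, and the lattice ideal of a trivial
   character; a component with vertex set C contributes the toric ideal of the
   complete bipartite graph between {u_c, v_c} and {t_i : i in C}.
   Conversely, if i and j are neighbours of k then
   y_k (x_i y_j - x_j y_i) is in J_G. Primality, or the lattice property, cancels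
   y_k, and setting x_i = y_j = 1 and all other variables to 0 shows that
   x_i y_j - x_j y_i can only be in J_G if {i,j} is an edge. *)
Require Import Defs.
From HB Require Import structures.
From mathcomp Require Import all_boot all_order all_algebra.
From mathcomp Require Import boolp ssrcomplements mpoly zify ring.

Set Implicit Arguments.
Unset Strict Implicit.
Unset Printing Implicit Defensive.

Import Order.TTheory GRing.Theory Num.Theory.
Local Open Scope ring_scope.

(** * Ideals: generation, sums and kernels *)

Section IdealTheory.
Variable R : comNzRingType.
Implicit Types (A : R -> Prop) (I : {pred R}).

(* The library's [idealr_closed] minus properness. *)
Definition ideal_closed I : Prop :=
  0 \in I /\ forall a, {in I &, forall u v, a * u + v \in I}.

Lemma ideal_closedM I a u : ideal_closed I -> u \in I -> a * u \in I.
Proof. by case=> I0 Ilin uI; rewrite -[a * u]addr0 Ilin. Qed.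

Lemma ideal_closedD I u v : ideal_closed I -> u \in I -> v \in I -> u + v \in I.
Proof. by case=> I0 Ilin uI vI; rewrite -[u]mul1r Ilin. Qed.

Lemma ideal_closedB I u v : ideal_closed I -> u \in I -> v \in I -> u - v \in I.
Proof. by case=> I0 Ilin uI vI; rewrite addrC -mulN1r Ilin. Qed.

Lemma ideal_closed_sum I (T : eqType) (s : seq T) (P : pred T) F :
  ideal_closed I -> (forall x, x \in s -> P x -> F x \in I) ->
  \sum_(x <- s | P x) F x \in I.
Proof.
move=> Iid FI; rewrite big_seq_cond.
elim/big_ind: _ => [|u v|x /andP[]]; [exact: Iid.1|exact: ideal_closedD|].
exact: FI.
Qed.

Lemma ideal_gen_closed A : ideal_closed (ideal_gen A).
Proof.
split=> [|a u v]; first by apply/asboolP; exists [::]; rewrite big_nil.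
move=> /asboolP[s [sA ->]] /asboolP[s' [s'A ->]]; apply/asboolP.
exists ([seq (a * p.1, p.2) | p <- s] ++ s'); split.
  by move=> p; rewrite mem_cat => /orP[/mapP[q /sA qA ->]|/s'A].
rewrite big_cat big_map mulr_sumr; congr (_ + _).
by apply: eq_bigr => p _; rewrite mulrA.
Qed.

Lemma mem_ideal_gen A f : A f -> f \in ideal_gen A.
Proof.
move=> Af; apply/asboolP; exists [:: (1, f)]; split=> [p|].
  by rewrite inE => /eqP->.
by rewrite big_seq1 mul1r.
Qed.

Lemma ideal_gen_sub A I : ideal_closed I -> (forall f, A f -> f \in I) ->
  {subset ideal_gen A <= I}.
Proof.
move=> Iid AI f /asboolP[s [sA ->]].
by apply: ideal_closed_sum => // p /sA/AI pI _; exact: ideal_closedM.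
Qed.

Lemma ideal_sum_closed (s : nat) (I : 'I_s -> {pred R}) :
  (forall j, ideal_closed (I j)) -> ideal_closed (ideal_sum I).
Proof.
move=> Iid; split=> [|a u v].
  by apply/asboolP; exists (fun=> 0); rewrite big1 //; split=> // j; case: (Iid j).
move=> /asboolP[g [gI ->]] /asboolP[h [hI ->]]; apply/asboolP.
exists (fun j => a * g j + h j); split=> [j|]; first exact: (Iid j).2.
by rewrite big_split mulr_sumr.
Qed.

Lemma mem_ideal_sum (s : nat) (I : 'I_s -> {pred R}) j f :
  (forall j, ideal_closed (I j)) -> f \in I j -> f \in ideal_sum I.
Proof.
move=> Iid fI; apply/asboolP; exists (fun k => if k == j then f else 0).
split=> [k|]; first by case: eqP => [->|_] //; exact: (Iid k).1.
by rewrite -big_mkcond big_pred1_eq.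
Qed.

Lemma ideal_sum_sub (s : nat) (I : 'I_s -> {pred R}) (J : {pred R}) :
  ideal_closed J -> (forall j, {subset I j <= J}) -> {subset ideal_sum I <= J}.
Proof.
move=> Jid IJ f /asboolP[g [gI ->]].
by apply: ideal_closed_sum => // j _ _; apply: IJ (gI j).
Qed.

Lemma kernel_ideal_closed (S : pzRingType) (phi : {rmorphism R -> S}) :
  ideal_closed [pred f | phi f == 0].
Proof.
split=> [|a u v]; first by rewrite inE rmorph0.
rewrite !inE => /eqP u0 /eqP v0; by rewrite rmorphD rmorphM u0 v0 mulr0 addr0.
Qed.

Lemma kernel_prime (S : idomainType) (phi : {rmorphism R -> S}) (I : {pred R}) :
  (forall f, (f \in I) = (phi f == 0)) -> prime_ideal I.
Proof.
move=> IE; split; last by move=> u v; rewrite !IE rmorphM mulf_eq0.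
split=> [||a u v]; rewrite !IE ?rmorph0 ?rmorph1 ?oner_eq0 //.
by move=> /eqP u0 /eqP v0; rewrite rmorphD rmorphM u0 v0 mulr0 addr0.
Qed.

End IdealTheory.

(** * Monomial maps and their kernels *)

Section MonomialMaps.
Variables (K : fieldType) (N M : nat) (e : 'I_N -> 'X_{1..M}).
Implicit Types (p q : 'X_{1..N}) (f : {mpoly K[N]}).

Definition exponent_map p : 'X_{1..M} := (\sum_(k < N) e k *+ p k)%MM.

Lemma exponent_mapD p q :
  exponent_map (p + q)%MM = (exponent_map p + exponent_map q)%MM.
Proof.
apply/mnmP => l; rewrite mnmDE !mnm_sumE -big_split; apply: eq_bigr => k _.
by rewrite !mulmnE mnmDE mulnDr.
Qed.

Lemma exponent_mapU k : exponent_map U_(k)%MM = e k.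
Proof.
apply/mnmP => l; rewrite mnm_sumE (bigD1 k) //= big1 => [|k' /negPf kk'].
  by rewrite mulmnE mnm1E eqxx muln1 addn0.
by rewrite mulmnE mnm1E eq_sym kk' muln0.
Qed.

Definition monomial_map : {mpoly K[N]} -> {mpoly K[M]} :=
  comp_mpoly [tuple 'X_[e k] | k < N].

HB.instance Definition _ := GRing.LRMorphism.copy monomial_map monomial_map.

Lemma monomial_mapXU k : monomial_map 'X_k = 'X_[e k].
Proof. by rewrite /monomial_map comp_mpolyXU -tnth_nth tnth_mktuple. Qed.

Lemma monomial_mapX p : monomial_map 'X_[p] = 'X_[exponent_map p].
Proof.
rewrite /monomial_map comp_mpolyX (big_morph _ (@mpolyXD M K) (mpolyX0 M K)).
by apply: eq_bigr => k _; rewrite tnth_mktuple mpolyXn.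
Qed.

Lemma monomial_mapE f :
  monomial_map f = \sum_(p <- msupp f) f@_p *: 'X_[exponent_map p].
Proof.
rewrite {1}[f]mpolyE (raddf_sum monomial_map); apply: eq_bigr => p _.
by rewrite /= [LHS]linearZ /= monomial_mapX.
Qed.

(* Replacing each monomial by a representative chosen in its fibre changes
   [f] by an element of [I], and turns [f] into 0 when [f] is in the kernel. *)
Lemma monomial_map_kernel_sub (I : {pred {mpoly K[N]}}) :
  ideal_closed I ->
  (forall p q, exponent_map p = exponent_map q -> 'X_[p] - 'X_[q] \in I) ->
  forall f, monomial_map f = 0 -> f \in I.
Proof.
move=> Iid binI f f0.
pose rep p := choose (fun q => exponent_map q == exponent_map p) p.
have repE p : exponent_map (rep p) = exponent_map p.
  by apply/eqP/(@chooseP _ (fun q => exponent_map q == exponent_map p)).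
have rep_eq p q : (rep p == rep q) = (exponent_map p == exponent_map q).
  apply/eqP/eqP => [rpq|epq]; first by rewrite -repE rpq repE.
  rewrite /rep epq; apply: choose_id; by rewrite ?epq.
suff g0 : \sum_(p <- msupp f) f@_p *: 'X_[rep p] = 0 :> {mpoly K[N]}.
  rewrite -[f]subr0 -g0 {1}[f]mpolyE -sumrB.
  apply: ideal_closed_sum => // p _ _.
  by rewrite -scalerBr -mul_mpolyC; apply: ideal_closedM => //; apply: binI.
apply/mpolyP => q; rewrite mcoeff0 raddf_sum /=.
have [/hasP[p0 _ /eqP<-]|/hasPn q_rep] :=
    boolP (has (fun p => rep p == q) (msupp f)); last first.
  rewrite big_seq big1 // => p /q_rep/negPf pq.
  by rewrite mcoeffZ mcoeffX pq mulr0.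
(* The coefficient at [rep p0] collects the coefficients of [f] over the fibre of [p0]; this is also
   the coefficient of the common image monomial in the image of [f]. *)
rewrite -[RHS](mcoeff0 K (exponent_map p0)) -f0.
rewrite monomial_mapE raddf_sum /=.
by apply: eq_bigr => p _; rewrite !mcoeffZ !mcoeffX rep_eq.
Qed.

End MonomialMaps.

(** * The monomial map of a disjoint union of complete graphs *)

Section ComponentMap.
Variables (K : fieldType) (n : nat) (c : 'I_n -> 'I_n).
Implicit Types (i j : 'I_n) (p q : 'X_{1..n + n}).

(** The target variables form three blocks of length [n]: the [t_i], then the [u_c], then the [v_c],
    with components named by values of [c]. *)
Definition comp_exponent (k : 'I_(n + n)) : 'X_{1..n + (n + n)} :=
  match split k with
  | inl i => (U_(lshift _ i) + U_(rshift n (lshift n (c i))))%MM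
  | inr i => (U_(lshift _ i) + U_(rshift n (rshift n (c i))))%MM
  end.

Lemma comp_exponent_x i :
  comp_exponent (lshift n i) =
    (U_(lshift _ i) + U_(rshift n (lshift n (c i))))%MM.
Proof. by rewrite /comp_exponent (unsplitK (inl i)). Qed.

Lemma comp_exponent_y i :
  comp_exponent (rshift n i) =
    (U_(lshift _ i) + U_(rshift n (rshift n (c i))))%MM.
Proof. by rewrite /comp_exponent (unsplitK (inr i)). Qed.

(** This and the next lemma give the fibre invariants behind the exchange argument: the joint degree
    at a vertex and the x-degree of a component. *)
Lemma exponent_map_vertex p i :
  exponent_map comp_exponent p (lshift _ i) =
    (p (lshift n i) + p (rshift n i))%N.
Proof.
rewrite /exponent_map mnm_sumE big_split_ord /=.
congr (_ + _)%N; rewrite (bigD1 i) //= big1 => [|j /negPf ji];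
  rewrite mulmnE ?comp_exponent_x ?comp_exponent_y mnmDE !mnm1E
     eq_lshift eq_rlshift ?eqxx ?ji; lia.
Qed.

Lemma exponent_map_component p i :
  exponent_map comp_exponent p (rshift n (lshift n (c i))) =
    (\sum_(j | c j == c i) p (lshift n j))%N.
Proof.
rewrite /exponent_map mnm_sumE big_split_ord /= [X in (_ + X)%N]big1 => [|j _].
  rewrite addn0 [RHS]big_mkcond; apply: eq_bigr => j _.
  rewrite mulmnE comp_exponent_x mnmDE !mnm1E eq_lrshift add0n.
  rewrite eq_rshift eq_lshift.
  by case: eqP; rewrite ?mul1n.
rewrite mulmnE comp_exponent_y mnmDE !mnm1E eq_lrshift.
by rewrite eq_rshift eq_rlshift.
Qed.

Variable G : sgraph 'I_n.
(** [G] is a disjoint union of complete graphs on the fibres of [c]. *)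
Hypothesis adjE : forall i j, G i j = (i != j) && (c i == c j).

Let J := binomial_edge_ideal K G.

Lemma binomial_edge_closed : ideal_closed J.
Proof. exact: ideal_gen_closed. Qed.

(** Write [p] as [r x_i y_j] and take [q] to be [r x_j y_i]: the difference is [r] times a
    generator, and the images agree because [c i = c j]. *)
Lemma monomial_exchange p i j :
  G i j -> p (lshift n i) != 0%N -> p (rshift n j) != 0%N ->
  exists2 q, 'X_[p] - 'X_[q] \in J &
    [/\ q (lshift n i) = (p (lshift n i)).-1,
        q (lshift n j) = (p (lshift n j)).+1,
        forall l, l != i -> l != j -> q (lshift n l) = p (lshift n l) &
        exponent_map comp_exponent q = exponent_map comp_exponent p].
Proof.
rewrite -!lep1mP => Gij le_ip le_jp.
have /andP[ne_ij /eqP cij] : (i != j) && (c i == c j) by rewrite -adjE.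
pose r := (p - U_(lshift n i) - U_(rshift n j))%MM.
have pE : p = (r + U_(rshift n j) + U_(lshift n i))%MM.
  rewrite /r !submK //; apply/mnm_lepP => k; rewrite mnmBE !mnm1E.
  have := mnm_lepP le_jp k; rewrite mnm1E; case: eqP => // <-.
  by rewrite eq_lrshift subn0.
exists (r + U_(rshift n i) + U_(lshift n j))%MM.
  have -> : 'X_[p] - 'X_[r + U_(rshift n i) + U_(lshift n j)] =
      'X_[r] * (varx K i * vary K j - varx K j * vary K i).
    by rewrite {1}pE !mpolyXD /varx /vary; ring.
  apply: ideal_closedM binomial_edge_closed _.
  by apply: mem_ideal_gen; exists i, j.
split; rewrite ?pE; try move=> l li lj.
- by rewrite !mnmDE !mnm1E !eq_lshift !eq_rlshift eqxx (eq_sym j) (negPf ne_ij); lia.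
- by rewrite !mnmDE !mnm1E !eq_lshift !eq_rlshift eqxx (negPf ne_ij); lia.
- rewrite !mnmDE !mnm1E !eq_lshift !eq_rlshift.
  by rewrite (eq_sym i) (eq_sym j) (negPf li) (negPf lj).
rewrite !exponent_mapD !exponent_mapU !comp_exponent_x !comp_exponent_y cij.
by apply/mnmP => k; rewrite !mnmDE; lia.
Qed.

(* If [p] has a larger exponent at [x_i] than [q], then it has a smaller one at
   [x_j] for some [j] in the component of [i]. As the total degrees at [j] agree,
   [y_j] divides [p], and [x_i y_j] may be traded for [x_j y_i]. *)
Lemma fibre_binomial_mem p q :
  exponent_map comp_exponent p = exponent_map comp_exponent q ->
  'X_[p] - 'X_[q] \in J.
Proof.
(* Each exchange lowers this truncated x-distance from [p] to [q], so it bounds the induction. *)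
pose excess p := (\sum_i (p (lshift n i) - q (lshift n i)))%N.
move: {2}(excess p) (leqnn (excess p)) => d.
elim: d p => [|d IHd] p; rewrite /excess => le_d Epq.
  (* With no excess, the x-exponents of [p] are at most those of [q]; equal sums over components
     make them equal, and the joint degrees then fix the y-exponents. *)
  have le_pq i : (p (lshift n i) <= q (lshift n i))%N.
    by move: le_d; rewrite leqn0 sum_nat_eq0 => /forallP/(_ i) /=; rewrite subn_eq0.
  have eqx i : p (lshift n i) = q (lshift n i).
    have /eqP := congr1 (fun m : 'X_{1.._} => m (rshift n (lshift n (c i)))) Epq.
    rewrite !exponent_map_component; apply: contraTeq => ne_i.
    rewrite neq_ltn (bigD1 i) //= [ltnRHS](bigD1 i) //= -addSn leq_add //.
      by rewrite ltn_neqAle ne_i le_pq.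
    exact: leq_sum.
  have eqy i : p (rshift n i) = q (rshift n i).
    have /eqP := congr1 (fun m : 'X_{1.._} => m (lshift _ i)) Epq.
    by rewrite !exponent_map_vertex eqx eqn_add2l => /eqP.
  suff -> : p = q by rewrite subrr; exact: binomial_edge_closed.1.
  by apply/mnmP => k; case: (split_ordP k) => i ->.
have [/forallP le_pq|] := boolP [forall i, p (lshift n i) <= q (lshift n i)]%N.
  apply: IHd => //; rewrite /excess big1 // => i _.
  by apply/eqP; rewrite subn_eq0 le_pq.
case/forallPn => i; rewrite -ltnNge => lt_i.
have [j /andP[/eqP cji lt_j]] :
    exists j, (c j == c i) && (p (lshift n j) < q (lshift n j))%N.
  apply/existsP; apply: contraTT (lt_i) => /existsPn ge_pq; rewrite -leqNgt.
  have := congr1 (fun m : 'X_{1.._} => m (rshift n (lshift n (c i)))) Epq.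
  rewrite !exponent_map_component (bigD1 i) //= [RHS](bigD1 i) //= => Ei.
  rewrite -(leq_add2r (\sum_(j | (c j == c i) && (j != i)) p (lshift n j))) Ei.
  rewrite leq_add2l; apply: leq_sum => j /andP[cji _].
  by have := ge_pq j; rewrite cji /= -leqNgt.
have ne_ij : i != j by apply: contraTneq lt_i => ->; rewrite -leqNgt ltnW.
have Ej := congr1 (fun m : 'X_{1.._} => m (lshift _ j)) Epq.
rewrite !exponent_map_vertex in Ej.
have [||| r pr [ri rj rl Er]] := @monomial_exchange p i j.
- by rewrite adjE ne_ij cji eqxx.
- by rewrite -lt0n (leq_ltn_trans _ lt_i).
- by lia.
have -> : 'X_[p] - 'X_[q] = ('X_[p] - 'X_[r]) + ('X_[r] - 'X_[q]) :> {mpoly K[n + n]}.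
  by rewrite addrA subrK.
apply: ideal_closedD binomial_edge_closed pr _; apply: IHd; last by rewrite Er.
(* The term at [i] drops by one. The term at [j] stays 0, since [p] was strictly below [q] there. *)
rewrite -ltnS (leq_trans _ le_d) // /excess.
rewrite (bigD1 i) //= [ltnRHS](bigD1 i) //= -addSn leq_add //; first by lia.
apply: leq_sum => l li; have [->|lj] := eqVneq l j; first by lia.
by rewrite rl.
Qed.

(** Fibre binomials give one inclusion. For the other, both terms of a generator map to
    [t_i t_j u_c v_c], as [i] and [j] share the component [c]. *)
Lemma binomial_edge_kernel f :
  (f \in J) = (monomial_map comp_exponent f == 0).
Proof.
apply/idP/eqP => [|f0]; last first.
  apply: monomial_map_kernel_sub f0 => //; first exact: binomial_edge_closed.
  exact: fibre_binomial_mem.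
pose I : {pred {mpoly K[n + n]}} := [pred f | monomial_map comp_exponent f == 0].
suff JI : {subset J <= I} by move=> /JI/eqP.
apply: ideal_gen_sub => [|_ [i [j [Gij ->]]]].
  exact: (kernel_ideal_closed (monomial_map comp_exponent)).
move: Gij; rewrite adjE inE => /andP[_ /eqP cij].
rewrite rmorphB !rmorphM /= !monomial_mapXU !comp_exponent_x !comp_exponent_y.
by rewrite -cij !mpolyXD; apply/eqP; ring.
Qed.

End ComponentMap.

(** * Linear functionals prescribed on monomials *)

Section LinearExtension.
Variables (K : fieldType) (N : nat) (tau : 'X_{1..N} -> K).
Implicit Types (p : 'X_{1..N}) (f g : {mpoly K[N]}).

Definition mpoly_lin f : K := \sum_(p <- msupp f) f@_p * tau p.

(** A common index set for several polynomials, so that linearity can be checked termwise. *)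
Lemma mpoly_linE f k : (msize f <= k)%N ->
  mpoly_lin f = \sum_(p : 'X_{1..N < k}) f@_p * tau p.
Proof.
move=> le_fk; rewrite /mpoly_lin (big_mksub 'X_{1..N < k}) ?msupp_uniq //=.
  by rewrite big_rmcond //= => p /memN_msupp_eq0 ->; rewrite mul0r.
by move=> p /msize_mdeg_lt /leq_trans; apply.
Qed.

Lemma mpoly_lin_is_linear : scalar mpoly_lin.
Proof.
move=> a f g; pose k := maxn (msize (a *: f + g)) (maxn (msize f) (msize g)).
rewrite !(@mpoly_linE _ k) ?leq_max ?leqnn ?orbT // mulr_sumr -big_split.
by apply: eq_bigr => p _; rewrite mcoeffD mcoeffZ mulrDl mulrA.
Qed.

HB.instance Definition _ :=
  GRing.isLinear.Build K {mpoly K[N]} K *%R mpoly_lin mpoly_lin_is_linear.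

Lemma mpoly_linX p : mpoly_lin 'X_[p] = tau p.
Proof. by rewrite /mpoly_lin msuppX big_seq1 mcoeffX eqxx mul1r. Qed.

End LinearExtension.

(** * Lattice ideals and cancellation of monomials *)

Section LatticeIdeals.
Variables (K : fieldType) (N : nat).
Implicit Types (p q r : 'X_{1..N}) (rho : partial_character K N).

Definition mnm_diff p q : 'rV[int]_N := \row_i ((p i)%:Z - (q i)%:Z).

(** The exponent of the gcd; dividing it out leaves the positive and negative parts of the
    difference. *)
Definition mnm_min p q : 'X_{1..N} := [multinom minn (p i) (q i) | i < N].

Lemma pos_part_diffK p q : (mnm_min p q + pos_part (mnm_diff p q))%MM = p.
Proof. by apply/mnmP => i; rewrite mnmDE !mnmE mxE; lia. Qed.

Lemma neg_part_diffK p q : (mnm_min p q + neg_part (mnm_diff p q))%MM = q.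
Proof. by apply/mnmP => i; rewrite mnmDE !mnmE !mxE; lia. Qed.

Lemma mnm_diffDl r p q : mnm_diff (r + p) (r + q) = mnm_diff p q.
Proof. by apply/rowP => i; rewrite !mxE !mnmDE; lia. Qed.

Lemma mnm_diffpp p : mnm_diff p p = 0.
Proof. by apply/rowP => i; rewrite !mxE subrr. Qed.

Lemma character_ideal_binomial rho p q :
  mnm_diff p q \in pc_lattice rho ->
  'X_[p] - rho (mnm_diff p q) *: 'X_[q] \in character_ideal rho.
Proof.
move=> Lpq.
set m := mnm_diff p q in Lpq *.
have -> : 'X_[p] - rho m *: 'X_[q] =
    'X_[mnm_min p q] * ('X_[pos_part m] - rho m *: 'X_[neg_part m]).
  by rewrite mulrBr -scalerAr -!mpolyXD pos_part_diffK neg_part_diffK.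
apply: ideal_closedM; first exact: ideal_gen_closed.
by apply: mem_ideal_gen; exists m.
Qed.

(* The functional reading off, with weights [rho], the coefficients of the
   monomials congruent to [q] modulo the lattice. *)
Definition class_weight rho q p : K :=
  if mnm_diff p q \in pc_lattice rho then rho (mnm_diff p q) else 0.

Lemma character0 rho : rho 0 = 1.
Proof.
have [L0 _] := pc_lattice_closed rho.
have := pc_morph L0 L0; rewrite addr0 => rho00.
by apply: (mulfI (pc_neq0 L0)); rewrite -rho00 mulr1.
Qed.

(** The two exponents differ by [m], so both or neither are congruent to [q], and [rho] is
    multiplicative. Hence the functional kills monomial multiples of generators. *)
Lemma class_weight_binomial rho q r (m : 'rV[int]_N) :
  m \in pc_lattice rho ->
  class_weight rho q (r + pos_part m) =
    rho m * class_weight rho q (r + neg_part m).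
Proof.
move=> Lm; rewrite /class_weight.
have -> : mnm_diff (r + pos_part m) q = m + mnm_diff (r + neg_part m) q.
  by apply/rowP => i; rewrite !mxE !mnmDE !mnmE !mxE; move: (m 0 i) => z; lia.
have [_ Lsub] := pc_lattice_closed rho.
have LD u : (m + u \in pc_lattice rho) = (u \in pc_lattice rho).
  apply/idP/idP => [Lmu|Lu]; first by rewrite -[u](addKr m) addrC Lsub.
  by rewrite -[u]opprK Lsub // -[- u]add0r Lsub //; case: (pc_lattice_closed rho).
by rewrite LD; case: ifP => Lu; rewrite ?mulr0 // pc_morph.
Qed.

Lemma class_weight_character_ideal rho q f :
  f \in character_ideal rho -> mpoly_lin (class_weight rho q) f = 0.
Proof.
move=> /asboolP[s [sgen ->]]; rewrite raddf_sum big_seq big1 // => -[a b] /=.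
move=> /sgen[m Lm /= ->]; rewrite [a]mpolyE mulr_suml raddf_sum big1 //= => r _.
rewrite -scalerAl linearZ /= mulrBr -scalerAr -!mpolyXD linearB linearZ /=.
by rewrite !mpoly_linX class_weight_binomial // subrr mulr0.
Qed.

(** Apply the functional of the class of [r + q]. If [p - q] is outside the lattice the value is -1,
    a contradiction; otherwise it is [rho (p - q) - 1], so [rho (p - q) = 1] and the binomial
    already lies in the ideal. *)
Lemma lattice_ideal_cancel rho r p q :
  'X_[r] * ('X_[p] - 'X_[q]) \in character_ideal rho ->
  'X_[p] - 'X_[q] \in character_ideal rho.
Proof.
rewrite mulrBr -!mpolyXD => /(class_weight_character_ideal (r + q)%MM)/eqP.
rewrite linearB /= !mpoly_linX /class_weight !mnm_diffDl mnm_diffpp character0.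
have [-> _] := pc_lattice_closed rho.
case: ifP => [Lpq|_]; last by rewrite sub0r oppr_eq0 oner_eq0.
rewrite subr_eq0 => /eqP rho1.
by have := character_ideal_binomial Lpq; rewrite rho1 scale1r.
Qed.

End LatticeIdeals.

(** * Kernels of monomial maps as lattice and toric ideals *)

Section ToricIsLattice.
Variables (K : fieldType) (N M : nat) (e : 'I_N -> 'X_{1..M}).

(** The kernel of the integer-linear extension of [exponent_map e], phrased with nonnegative
    exponents only. *)
Definition kernel_lattice : {pred 'rV[int]_N} :=
  [pred m | exponent_map e (pos_part m) == exponent_map e (neg_part m)].

Lemma kernel_lattice_diff p q :
  (mnm_diff p q \in kernel_lattice) = (exponent_map e p == exponent_map e q).
Proof.
rewrite inE -(eqm_add2l (exponent_map e (mnm_min p q))) -!exponent_mapD.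
by rewrite pos_part_diffK neg_part_diffK.
Qed.

Lemma mnm_diff_parts (m : 'rV[int]_N) : m = mnm_diff (pos_part m) (neg_part m).
Proof. by apply/rowP => i; rewrite !mxE !mnmE !mxE; move: (m 0 i) => z; lia. Qed.

Lemma kernel_lattice_closed : zmod_closed kernel_lattice.
Proof.
split=> [|m m']; first by rewrite (mnm_diff_parts 0) kernel_lattice_diff /neg_part oppr0.
move=> /eqP Em /eqP Em'.
have -> : m - m' =
    mnm_diff (pos_part m + neg_part m')%MM (neg_part m + pos_part m')%MM.
  by apply/rowP => i; rewrite !mxE !mnmDE !mnmE !mxE; move: (m 0 i) (m' 0 i) => z z'; lia.
by rewrite kernel_lattice_diff !exponent_mapD Em Em'.
Qed.

Definition kernel_character : partial_character K N :=
  @PartialCharacter K N kernel_lattice (fun=> 1) kernel_lattice_closed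
    (fun _ _ => oner_neq0 K) (fun _ _ _ _ => esym (mulr1 1)).

Lemma monomial_map_kernel_lattice (I : {pred {mpoly K[N]}}) :
  (forall f, (f \in I) = (monomial_map e f == 0)) -> is_lattice_ideal I.
Proof.
move=> IE; exists kernel_character => f.
apply/idP/idP; last first.
  apply: ideal_gen_sub => [|_ [m Lm ->]].
    have [I0 Ilin] := kernel_ideal_closed (monomial_map (K := K) e).
    by split=> [|a u v]; rewrite !IE; [exact: I0|exact: Ilin].
  by rewrite IE scale1r rmorphB /= !monomial_mapX (eqP Lm) subrr.
rewrite IE => /eqP; apply: monomial_map_kernel_sub; first exact: ideal_gen_closed.
move=> p q Epq; rewrite -[in X in _ - X](scale1r 'X_[q]).
apply: (@character_ideal_binomial _ _ kernel_character).
by rewrite kernel_lattice_diff Epq.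
Qed.

Lemma monomial_map_kernel_toric (I : {pred {mpoly K[N]}}) :
  (forall f, (f \in I) = (monomial_map e f == 0)) -> is_toric_ideal I.
Proof.
move=> IE; exists M, (monomial_map e); split=> // k.
by exists (e k); exact: monomial_mapXU.
Qed.

End ToricIsLattice.

(** * Complete bipartite graphs, with edges as pairs *)

Section CompleteBipartite.
Variables A B : finType.

Definition bipartite_adj : rel (A + B)%type := fun u v => is_inl u != is_inl v.

Lemma bipartite_adj_sym : ssrbool.symmetric bipartite_adj.
Proof. by move=> u v; rewrite /bipartite_adj eq_sym. Qed.

Lemma bipartite_adj_irrefl : irreflexive bipartite_adj.
Proof. by move=> u; rewrite /bipartite_adj eqxx. Qed.

Definition bipartite_graph : sgraph (A + B)%type :=
  SGraph bipartite_adj_sym bipartite_adj_irrefl.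

Lemma bipartite_graph_complete (a : A) (b : B) :
  complete_bipartite bipartite_graph.
Proof.
exists [set u | is_inl u] => [|u v]; last by rewrite !inE.
by split; apply/set0Pn; [exists (inl a)|exists (inr b)]; rewrite !inE.
Qed.

Lemma mem_bipartite_edges (a : A) (b : B) :
  [set inl a; inr b] \in edges bipartite_graph.
Proof.
rewrite inE; apply/existsP; exists (inl a); apply/existsP; exists (inr b).
by rewrite eqxx.
Qed.

Let E := 'I_#|edges bipartite_graph|.

Lemma edge_ends_exist (k : E) :
  exists ab : A * B, enum_val k == [set inl ab.1; inr ab.2].
Proof.
have := enum_valP k; rewrite inE => /existsP[u /existsP[v /andP[]]].
case: u v => [a|b] [a'|b'] //= _ /eqP->; first by exists (a, b').
by exists (a', b); rewrite setUC.
Qed.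

(** Orders the ends of an edge by side; this is a bijection from edges to pairs. *)
Definition edge_ends (k : E) : A * B := xchoose (edge_ends_exist k).

Lemma enum_val_edge (k : E) :
  enum_val k = [set inl (edge_ends k).1; inr (edge_ends k).2].
Proof. exact/eqP/(xchooseP (edge_ends_exist k)). Qed.

Lemma edge_ends_inj : injective edge_ends.
Proof. by move=> k k' eq_ends; apply: enum_val_inj; rewrite !enum_val_edge eq_ends. Qed.

Lemma edge_ends_surj (a : A) (b : B) : exists k, edge_ends k = (a, b).
Proof.
exists (enum_rank_in (mem_bipartite_edges a b) [set inl a; inr b]).
set k := enum_rank_in _ _.
have : enum_val k = [set inl a; inr b] by rewrite enum_rankK_in ?mem_bipartite_edges.
rewrite enum_val_edge; case: (edge_ends k) => a' b' /= /setP eq_ab.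
have := eq_ab (inl a); have := eq_ab (inr b).
by rewrite !inE !eqxx !orbT /= orbF => /eqP[->] /eqP[->].
Qed.

Lemma bipartite_edge_monomial (K : fieldType) (k : E) :
  edge_monomial K k = 'X_(enum_rank (inl (edge_ends k).1 : A + B)%type) *
                      'X_(enum_rank (inr (edge_ends k).2 : A + B)%type).
Proof. by rewrite /edge_monomial enum_val_edge big_setU1 ?inE //= big_set1. Qed.

End CompleteBipartite.

Lemma comp_mpolyA (R : comNzRingType) (n k l : nat) (f : {mpoly R[n]})
    (s : n.-tuple {mpoly R[k]}) (t : k.-tuple {mpoly R[l]}) :
  (f \mPo s) \mPo t = f \mPo [tuple tnth s i \mPo t | i < n].
Proof.
rewrite [f \mPo s]comp_mpolyE [RHS]comp_mpolyE raddf_sum; apply: eq_bigr => p _ /=.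
rewrite linearZ rmorph_prod; congr (_ *: _); apply: eq_bigr => i _ /=.
by rewrite rmorphXn tnth_mktuple.
Qed.

(** * The bipartite graph and toric ideal of one component *)

Section ComponentBipartite.
Variables (K : fieldType) (n : nat) (c : 'I_n -> 'I_n) (i : 'I_n).

Let C := {j : 'I_n | c j == c i}.
(** The apexes [true] and [false] stand for [u_c] and [v_c]. *)
Let H := bipartite_graph bool C.

Definition component_var (k : 'I_#|edges H|) : 'I_(n + n) :=
  let: (isx, j) := edge_ends k in
  if isx then lshift n (val j) else rshift n (val j).

Lemma component_var_inj : injective component_var.
Proof.
move=> k k'; rewrite /component_var => eq_var; apply: edge_ends_inj.
case: (edge_ends k) (edge_ends k') eq_var => [[] j] [[] j'] /eqP.
- by rewrite eq_lshift => /eqP/val_inj->.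
- by rewrite eq_lrshift.
- by rewrite eq_rlshift.
by rewrite eq_rshift => /eqP/val_inj->.
Qed.

(* The edge monomials of [H] become the images of the matching variables when
   the two apexes are sent to the component variables and [j] to its vertex
   variable. *)
Lemma component_toric_ext_kernel :
  {subset graph_toric_ideal_ext (K := K) component_var <=
    [pred f | monomial_map (comp_exponent c) f == 0]}.
Proof.
apply: ideal_gen_sub => [|_ [h h0 ->]].
  exact: (kernel_ideal_closed (monomial_map (comp_exponent c))).
pose w (u : bool + C) : {mpoly K[n + (n + n)]} :=
  match u with
  | inl true => 'X_(rshift n (lshift n (c i)))
  | inl false => 'X_(rshift n (rshift n (c i)))
  | inr j => 'X_(lshift _ (val j))
  end.
rewrite inE /monomial_map comp_mpolyA.
suff -> : [tuple tnth [tuple 'X_(component_var k) | k < #|edges H|] l \mPo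
             [tuple 'X_[comp_exponent c k] | k < n + n] | l < #|edges H|] =
          [tuple tnth [tuple edge_monomial K k | k < #|edges H|] l \mPo
             [tuple w (enum_val k) | k < #|{: bool + C}|] | l < #|edges H|].
  by rewrite -comp_mpolyA (eqP h0) comp_mpoly0.
apply: eq_from_tnth => k; rewrite !tnth_mktuple bipartite_edge_monomial.
rewrite rmorphM /= !comp_mpolyXU -!tnth_nth !tnth_mktuple !enum_rankK.
rewrite /component_var; case: (edge_ends k) => -[] [j /= /eqP cj].
  by rewrite comp_exponent_x mpolyXD cj mulrC.
by rewrite comp_exponent_y mpolyXD cj mulrC.
Qed.

(** For distinct [a] and [b], the edges from the two apexes to them form a 4-cycle, and its two
    pairs of opposite edges have the same product of edge monomials. *)
Lemma component_binomial_mem a b : c a = c i -> c b = c i ->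
  varx K a * vary K b - varx K b * vary K a \in
    graph_toric_ideal_ext component_var.
Proof.
move=> /eqP ca /eqP cb; pose ja : C := Sub a ca; pose jb : C := Sub b cb.
have [xa xaE] := edge_ends_surj true ja; have [ya yaE] := edge_ends_surj false ja.
have [xb xbE] := edge_ends_surj true jb; have [yb ybE] := edge_ends_surj false jb.
apply: mem_ideal_gen; exists ('X_xa * 'X_yb - 'X_xb * 'X_ya).
  rewrite inE rmorphB !rmorphM /= !comp_mpolyXU -!tnth_nth !tnth_mktuple.
  by rewrite !bipartite_edge_monomial xaE yaE xbE ybE; apply/eqP; ring.
rewrite rmorphB !rmorphM /= !comp_mpolyXU -!tnth_nth !tnth_mktuple.
by rewrite /component_var xaE yaE xbE ybE.
Qed.

End ComponentBipartite.

(** * Connected components and completeness *)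

Section Components.
Variables (V : finType) (G : sgraph V).

Definition disjoint_union_of_complete : Prop :=
  forall i j, G i j = (i != j) && connect G i j.

Lemma adj_connect_sym : connect_sym G.
Proof. by apply: sym_connect_sym; exact: adj_sym. Qed.

Lemma complete_components_disjoint_union :
  (forall C : {set V}, C \in components G -> complete_on G C) ->
  disjoint_union_of_complete.
Proof.
move=> compl i j; apply/idP/andP => [Gij|[ne_ij Gcij]].
  split; last exact: connect1.
  by apply: contraTneq Gij => ->; rewrite adj_irrefl.
apply: (compl [set k in [set: V] | connect G i k]) ne_ij.
- exact/imset_f.
- by rewrite !inE connect0.
- by rewrite !inE.
Qed.

(** Induct along a path from [i] to [j] with second vertex [k]: either [k = j], or [k] is adjacent
    to [j] by induction and [i], [j] are both neighbours of [k]. *)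
Lemma complete_around_components :
  complete_around_all_vertices G ->
  forall C : {set V}, C \in components G -> complete_on G C.
Proof.
move=> around.
have conn_adj i j : connect G i j -> i != j -> G i j.
  case/connectP => s; elim: s i => [|k s IHs] i /=.
    by move=> _ ->; rewrite eqxx.
  case/andP=> Gik path_s j_last ne_ij.
  have [->//|ne_kj] := eqVneq j k.
  apply: (around k) ne_ij; first by rewrite inE.
  by rewrite inE adj_sym IHs // eq_sym.
move=> C /imsetP[k _ ->] i j; rewrite !inE /= => ki kj; apply: conn_adj.
by rewrite (connect_trans _ kj) // adj_connect_sym.
Qed.

End Components.

(** * Algebraic conditions on the binomial edge ideal *)

Section BinomialEdgeIdealConditions.
Variables (K : fieldType) (n : nat) (G : sgraph 'I_n).
Implicit Types i j k : 'I_n.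
Let J := binomial_edge_ideal K G.

(** A test for non-membership: evaluate at a common zero of the generators. *)
Lemma binomial_edge_meval0 (v : 'I_(n + n) -> K) :
  (forall a b, G a b -> v (lshift n a) * v (rshift n b) =
                        v (lshift n b) * v (rshift n a)) ->
  forall f, f \in J -> f.@[v] = 0.
Proof.
move=> v0 f; suff JI : {subset J <= [pred f | f.@[v] == 0]} by move=> /JI/eqP.
apply: ideal_gen_sub => [|_ [a [b [Gab ->]]]]; first by
  exact: (kernel_ideal_closed (meval v)).
by rewrite inE mevalB !mevalM /varx /vary !mevalXU v0 // subrr.
Qed.

Lemma vary_notin i : vary K i \notin J.
Proof.
(* All [x] are 0 and all [y] are 1; every term of a generator has an [x] factor. *)
pose v (k : 'I_(n + n)) : K := if split k is inr _ then 1 else 0.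
apply/negP => /(@binomial_edge_meval0 v) vi0; have /eqP := oner_neq0 K; apply.
rewrite -vi0 => [|a b _]; last by rewrite /v !(unsplitK (inl _)) !mul0r.
by rewrite /vary mevalXU /v (unsplitK (inr i)).
Qed.

Lemma edge_of_binomial_mem i j :
  i != j -> varx K i * vary K j - varx K j * vary K i \in J -> G i j.
Proof.
move=> ne_ij Jij; apply: contraT => nGij.
pose v (k : 'I_(n + n)) : K :=
  match split k with inl a => (a == i)%:R | inr b => (b == j)%:R end.
have vx a : v (lshift n a) = (a == i)%:R by rewrite /v (unsplitK (inl a)).
have vy b : v (rshift n b) = (b == j)%:R by rewrite /v (unsplitK (inr b)).
have v0 a b : G a b ->
    v (lshift n a) * v (rshift n b) = v (lshift n b) * v (rshift n a).
  move=> Gab; rewrite !vx !vy -!natrM !mulnb; congr (_%:R); congr nat_of_bool.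
  have Gba : G b a by rewrite adj_sym.
  (* A nonzero product on either side would make [{i, j}] the edge [{a, b}]. *)
  by transitivity false; [|symmetry]; apply: contraNF nGij => /andP[/eqP<- /eqP<-].
have /eqP := binomial_edge_meval0 v0 Jij.
rewrite mevalB !mevalM /varx /vary !mevalXU !vx !vy !eqxx (eq_sym j).
by rewrite (negPf ne_ij) mulr0 subr0 mulr1 oner_eq0.
Qed.

Lemma cancel_complete_around :
  (forall i j k, vary K k * (varx K i * vary K j - varx K j * vary K i) \in J ->
     varx K i * vary K j - varx K j * vary K i \in J) ->
  complete_around_all_vertices G.
Proof.
move=> cancelJ k i j; rewrite !inE => Gik Gjk ne_ij.
apply: edge_of_binomial_mem => //; apply: (cancelJ i j k).
have gen a b : G a b -> varx K a * vary K b - varx K b * vary K a \in J.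
  by move=> Gab; apply: mem_ideal_gen; exists a, b.
(* The syzygy among the 2x2 minors on columns [i], [j], [k] of the matrix with rows [x] and [y]. *)
have -> : vary K k * (varx K i * vary K j - varx K j * vary K i) =
    vary K j * (varx K i * vary K k - varx K k * vary K i)
    - vary K i * (varx K j * vary K k - varx K k * vary K j) by ring.
have Jid : ideal_closed J by exact: ideal_gen_closed.
by apply: (ideal_closedB Jid); apply: (ideal_closedM _ Jid); apply: gen.
Qed.

Lemma prime_complete_around : prime_ideal J -> complete_around_all_vertices G.
Proof.
case=> _ primeJ; apply: cancel_complete_around => i j k.
by move=> /primeJ; rewrite (negPf (vary_notin k)).
Qed.

Lemma lattice_complete_around :
  is_lattice_ideal J -> complete_around_all_vertices G.
Proof.
case=> rho JE; apply: cancel_complete_around => i j k.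
rewrite !JE /varx /vary -!mpolyXD; exact: lattice_ideal_cancel.
Qed.

(** A kernel of a homomorphism into a polynomial ring over a field is prime. *)
Lemma toric_complete_around :
  is_toric_ideal J -> complete_around_all_vertices G.
Proof.
case=> M [phi [_ JE]]; apply: prime_complete_around.
exact: (kernel_prime (phi := phi)).
Qed.

Lemma disjoint_union_kernel : disjoint_union_of_complete G ->
  forall f, (f \in J) = (monomial_map (comp_exponent (fingraph.root G)) f == 0).
Proof.
move=> complG; apply: binomial_edge_kernel => i j.
by rewrite complG root_connect //; exact: adj_connect_sym.
Qed.

Lemma disjoint_union_bipartite_sum : disjoint_union_of_complete G ->
  is_sum_of_complete_bipartite_toric J.
Proof.
move=> complG; pose c := fingraph.root G.
(* One summand per vertex, that of its component; repeating a component leaves the sum of ideals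
   unchanged. *)
exists n, (fun i => (bool + {j : 'I_n | c j == c i})%type : finType).
exists (fun i => bipartite_graph bool {j : 'I_n | c j == c i}).
exists (@component_var n c); split=> [i|i|f].
- exact: (bipartite_graph_complete true (exist _ i (eqxx (c i)))).
- exact: component_var_inj.
have ext_closed i : ideal_closed (graph_toric_ideal_ext (K := K) (@component_var n c i)).
  exact: ideal_gen_closed.
apply/idP/idP; last first.
  apply: ideal_sum_sub => [|i g /component_toric_ext_kernel].
    exact: ideal_gen_closed.
  by rewrite disjoint_union_kernel.
apply: ideal_gen_sub => [|_ [a [b [Gab ->]]]]; first exact: ideal_sum_closed.
apply: (@mem_ideal_sum _ _ _ a) => //; apply: component_binomial_mem => //.
apply/eqP; rewrite root_connect; last exact: adj_connect_sym.
by apply: connect1; rewrite adj_sym.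
Qed.

End BinomialEdgeIdealConditions.

Theorem corollary3p3 (K : fieldType) (n : nat) (G : sgraph 'I_n) :
  let J := binomial_edge_ideal K G in
  [<-> complete_around_all_vertices G;
       forall C : {set 'I_n}, C \in components G -> complete_on G C;
       prime_ideal J;
       is_lattice_ideal J;
       is_toric_ideal J /\ is_sum_of_complete_bipartite_toric J].
Proof.
move=> J.
(* Stated from (i), because (iii) to (iv) and (iv) to (v) first return to (i) and then use this
   kernel. *)
have kernelJ : complete_around_all_vertices G ->
    forall f, (f \in J) = (monomial_map (comp_exponent (fingraph.root G)) f == 0).
  move=> /complete_around_components/complete_components_disjoint_union.
  exact: disjoint_union_kernel.
tfae.
- exact: complete_around_components.
- move=> /complete_components_disjoint_union/(@disjoint_union_kernel K).
  exact: kernel_prime.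
- by move=> /prime_complete_around/kernelJ/monomial_map_kernel_lattice.
- move=> /lattice_complete_around around; split.
    exact: monomial_map_kernel_toric (kernelJ around).
  apply: disjoint_union_bipartite_sum.
  exact/complete_components_disjoint_union/complete_around_components.
- by case=> /toric_complete_around.
Qed.
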